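(* Let $m, q, s$ be positive integers, let $n = m^{qs}$, and let $\chi$ be a Dirichlet character mod $n$. If the conductor of $\chi$ is $d = m^{ts}$ for an integer $t$ with $1 \le t \le q$, then $$\sum_{\substack{k=1\\(k,n)_s=1}}^{n}(k-1,n)_s\, \chi(k) = \Phi_s(n)\,\tau_s(n/d).$$
   Context: $\mathbb{N}$ denotes the positive integers. For an integer $a \ge 0$ and positive integers $b, s$, the generalized gcd $(a,b)_s$ is the largest $l^s$ with $l \in \mathbb{N}$ dividing both $a$ and $b$ (every integer divides $0$, so $(0,b)_s$ is the largest $s$-th power dividing $b$). Klee's function is $\Phi_s(n) = \#\{m \in \mathbb{N} : 1 \le m \le n,\ (m,n)_s = 1\}$. The generalized divisor function $\tau_s(n)$ is the number of divisors of $n$ of the form $l^s$ with $l \in \mathbb{N}$. As usual, a Dirichlet character $\chi$ mod $n$ satisfies $\chi(k)=0$ when $k$ and $n$ are not coprime in the ordinary sense. *)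

(* Defs.v *)
From mathcomp Require Import all_boot all_order all_algebra.
From mathcomp Require Import complex reals.

Set Implicit Arguments.
Unset Strict Implicit.
Unset Printing Implicit Defensive.

Import GRing.Theory.

Local Open Scope ring_scope.

(* For b, s > 0, every l with l ^ s %| b satisfies l <= l ^ s <= b, so the
   bound on l loses nothing; l = 1 always qualifies. *)
Definition gen_gcd (s a b : nat) : nat :=
  (\max_(l < b.+1 | [&& 0 < l, l ^ s %| a & l ^ s %| b]) l ^ s)%N.

Definition klee_Phi (s n : nat) : nat :=
  (\sum_(1 <= m < n.+1 | gen_gcd s m n == 1) 1)%N.

(* Counts the divisors e, not the roots l; for e, s > 0, e = l ^ s forces
   0 < l <= e. *)
Definition gen_tau (s n : nat) : nat :=
  count (fun e : nat => [exists l : 'I_e.+1, e == (l ^ s)%N]) (divisors n).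

(* chi 1 = 1 follows from multiplicativity and chi 1 != 0. *)
Record dirichlet_character (R : realType) (n : nat) (chi : int -> R[i])
    : Prop := DirichletCharacter {
  dirichlet_mul : forall a b : int, chi (a * b) = chi a * chi b;
  dirichlet_periodic : forall a : int, chi (a + n%:Z) = chi a;
  dirichlet_eq0 : forall a : int, (chi a == 0) = ~~ coprimez a n%:Z
}.

Definition induced_modulus (R : realType) (n : nat) (chi : int -> R[i])
    (d : nat) : Prop :=
  (d %| n)%N /\
  forall a : int, coprimez a n%:Z -> (a = 1 %[mod d%:Z])%Z -> chi a = 1.

(* The conductor is the smallest induced modulus. *)
Definition is_conductor (R : realType) (n : nat) (chi : int -> R[i])
    (d : nat) : Prop :=
  induced_modulus n chi d /\
  forall d' : nat, induced_modulus n chi d' -> (d <= d')%N.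

(* Main.v *)
Require Import Defs.
From mathcomp Require Import all_boot all_order all_algebra.
From mathcomp Require Import complex reals ring.

Set Implicit Arguments.
Unset Strict Implicit.
Unset Printing Implicit Defensive.

Import GRing.Theory.

(** Write [n = N ^ s] with [N = m ^ q]. The generalized gcd satisfies
      [(j, n)_s] = sum of [Phi_s (l ^ s)] over the [l %| N] with [l ^ s %| j],
    the analogue of [n] = sum of [totient d] over [d %| n]
    ([gen_gcd_sum_klee]). When [(k, n)_s <> 1], k is not a unit mod n and
    [chi k = 0], so putting [k = j + 1] and exchanging the sums turns the
    left-hand side into the sum over [l %| N] of [Phi_s (l ^ s)] times
    [S l], the sum of [chi k] over the residues [k] mod n that are congruent
    to 1 mod [l ^ s].

    If [l ^ s] is an induced modulus, i.e. [d %| l ^ s], i.e. [m ^ t %| l],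
    then, since [t >= 1], l has all the primes of n: every such [k] is a unit,
    [chi k = 1], and [S l = n / l ^ s] ([sum_chi_induced]). For the same reason
    [Phi_s (l ^ s) * (n / l ^ s) = Phi_s n] ([klee_Phi_radical]). If [l ^ s]
    is not an induced modulus, [S l = 0] by orthogonality
    ([sum_chi_not_induced]). That the conductor, defined as the smallest
    induced modulus, divides every induced modulus comes from
    [induced_modulus_gcd].

    What remains is [Phi_s n] times the number of multiples of [m ^ t] among
    the divisors of [m ^ q], that is, the number of divisors of [m ^ (q - t)],
    which is [tau_s (n / d)] because [n / d = (m ^ (q - t)) ^ s]. *)

(** * The root of the generalized gcd *)

(** For b, s > 0, the l for which [gen_gcd s a b = l ^ s]; unlike the s-th
    power itself, it is characterized by a divisibility universal property. *)
Definition gen_gcd_root (s a b : nat) : nat :=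
  \max_(l < b.+1 | [&& 0 < l, l ^ s %| a & l ^ s %| b]) l.

(** Cancel the s-th power of the gcd of x and y from a: the remaining cofactors
    of x and y are coprime, so their s-th powers divide jointly. *)
Lemma dvdn_lcm_exp (s x y a : nat) : 0 < x ->
  x ^ s %| a -> y ^ s %| a -> lcmn x y ^ s %| a.
Proof.
move=> x_gt0 xa ya.
have g_gt0 : 0 < gcdn x y by rewrite gcdn_gt0 x_gt0.
pose g := gcdn x y; pose x' := x %/ g; pose y' := y %/ g.
have xE : x = x' * g by rewrite divnK // dvdn_gcdl.
have yE : y = y' * g by rewrite divnK // dvdn_gcdr.
have lE : lcmn x y = x' * y' * g.
  apply/eqP; rewrite -(eqn_pmul2r g_gt0) muln_lcm_gcd {1}xE {1}yE.
  by rewrite -/g mulnA [x' * g * y']mulnAC.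
have cop : coprime x' y'.
  rewrite /coprime -(eqn_pmul2r g_gt0) mul1n muln_gcdl -xE -yE //.
have /dvdnP[a' aE] : g ^ s %| a.
  by apply: dvdn_trans xa; apply: dvdn_exp2r; apply: dvdn_gcdl.
have gs_gt0 : 0 < g ^ s by rewrite expn_gt0 g_gt0.
move: xa ya; rewrite lE {1}xE {1}yE !expnMn aE !dvdn_pmul2r // => xa ya.
by rewrite Gauss_dvd ?xa ?ya // coprimeXl // coprimeXr.
Qed.

Section GenGcdRoot.

Variables s : nat.
Hypothesis s_gt0 : 0 < s.

Lemma leq_root_exp l : l <= l ^ s.
Proof. by case: l => // l; rewrite -{1}[l.+1]expn1 leq_pexp2l. Qed.

(** The admissible l are closed under lcm, so their maximum is a multiple of
    each of them. *)
Lemma dvdn_gen_gcd_root a b l : 0 < b ->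
  (l %| gen_gcd_root s a b) = (l ^ s %| a) && (l ^ s %| b).
Proof.
move=> b_gt0; pose P (l : nat) := [&& 0 < l, l ^ s %| a & l ^ s %| b].
have bnd k : k ^ s %| b -> k < b.+1.
  by move=> /(dvdn_leq b_gt0); rewrite ltnS; apply: leq_trans (leq_root_exp k).
have P1 : P 1 by rewrite /P exp1n !dvd1n.
have one_lt : 1 < b.+1 by rewrite ltnS.
have : P (gen_gcd_root s a b).
  rewrite /gen_gcd_root.
  rewrite (@bigmax_eq_arg _ (Ordinal one_lt) (fun i : 'I_b.+1 => P i)) //.
  by case: arg_maxnP.
have : forall k, P k -> k <= gen_gcd_root s a b.
  move=> k Pk; have /and3P[_ _ kb] := Pk.
  by apply: (leq_bigmax_cond (F := fun i : 'I_b.+1 => nat_of_ord i)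
    (Ordinal (bnd k kb))).
move: (gen_gcd_root s a b) => G maxG /and3P[G_gt0 Ga Gb].
apply/idP/andP => [lG | [la lb]].
  by split; [apply: dvdn_trans Ga | apply: dvdn_trans Gb]; apply: dvdn_exp2r.
have l_gt0 : 0 < l.
  by case: l la lb => // _; rewrite exp0n // dvd0n => /eqP b0; rewrite b0 in b_gt0.
have lcm_gt0 : 0 < lcmn l G by rewrite lcmn_gt0 l_gt0.
suff -> : G = lcmn l G by apply: dvdn_lcml.
apply/eqP; rewrite eqn_leq (dvdn_leq lcm_gt0 (dvdn_lcmr _ _)) /=.
by apply: maxG; rewrite /P lcm_gt0 !dvdn_lcm_exp.
Qed.

Lemma gen_gcd_root_gt0 a b : 0 < b -> 0 < gen_gcd_root s a b.
Proof.
move=> b_gt0; have := dvdn_gen_gcd_root a 0 b_gt0.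
by rewrite dvd0n exp0n // !dvd0n (gtn_eqF b_gt0) andbF lt0n => ->.
Qed.

Lemma gen_gcdE a b : 0 < b -> gen_gcd s a b = gen_gcd_root s a b ^ s.
Proof.
move=> b_gt0; have := dvdnn (gen_gcd_root s a b).
rewrite dvdn_gen_gcd_root // => /andP[Ga Gb].
apply/eqP; rewrite eqn_leq; apply/andP; split.
  apply/bigmax_leqP => l /and3P[_ la lb]; rewrite leq_exp2r //.
  by rewrite dvdn_leq ?gen_gcd_root_gt0 // dvdn_gen_gcd_root // la.
have G_lt : gen_gcd_root s a b < b.+1.
  by rewrite ltnS (leq_trans (leq_root_exp _)) // dvdn_leq.
apply: (@leq_bigmax_cond _ _ (fun i : 'I_b.+1 => i ^ s) (Ordinal G_lt)).
by rewrite /= gen_gcd_root_gt0 // Ga Gb.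
Qed.

Lemma gen_gcd_eq1 a b : 0 < b ->
  (gen_gcd s a b == 1) = (gen_gcd_root s a b == 1).
Proof. by move=> b_gt0; rewrite gen_gcdE // -{1}(exp1n s) eqn_exp2r. Qed.

Lemma gen_gcd_root_addr a b : 0 < b ->
  gen_gcd_root s (a + b) b = gen_gcd_root s a b.
Proof.
move=> b_gt0; apply/eqP; rewrite eqn_dvd !dvdn_gen_gcd_root //.
have := dvdnn (gen_gcd_root s a b); rewrite dvdn_gen_gcd_root // => /andP[? Gb].
have := dvdnn (gen_gcd_root s (a + b) b).
rewrite dvdn_gen_gcd_root // => /andP[+ Gb'].
by rewrite Gb Gb' !andbT dvdn_addl // => ->; rewrite dvdn_addl.
Qed.

Lemma gen_gcd_root_pmul2r g a b : 0 < g -> 0 < b ->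
  gen_gcd_root s (a * g ^ s) (b * g ^ s) = gen_gcd_root s a b * g.
Proof.
move=> g_gt0 b_gt0; have gs_gt0 : 0 < g ^ s by rewrite expn_gt0 g_gt0.
have bg_gt0 : 0 < b * g ^ s by rewrite muln_gt0 b_gt0.
have /dvdnP[h hE] : g %| gen_gcd_root s (a * g ^ s) (b * g ^ s).
  by rewrite dvdn_gen_gcd_root // !dvdn_mull.
have dvdh l : (l %| h) = (l %| gen_gcd_root s a b).
  by rewrite -(dvdn_pmul2r g_gt0) -hE !dvdn_gen_gcd_root // expnMn !dvdn_pmul2r.
by rewrite hE; congr (_ * _); apply/eqP; rewrite eqn_dvd dvdh dvdnn -dvdh dvdnn.
Qed.

(** A nontrivial [(a, L ^ s)_s] contains some [p ^ s] with p a prime divisor of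
    L, hence of l. *)
Lemma gen_gcd_root_eq1_radical a l L e : 0 < L -> l %| L -> L %| l ^ e ->
  (gen_gcd_root s a (l ^ s) == 1) = (gen_gcd_root s a (L ^ s) == 1).
Proof.
move=> L_gt0 lL Lle; have l_gt0 := dvdn_gt0 L_gt0 lL.
have Ls_gt0 : 0 < L ^ s by rewrite expn_gt0 L_gt0.
have ls_gt0 : 0 < l ^ s by rewrite expn_gt0 l_gt0.
apply/eqP/eqP => h; last first.
  apply/eqP; rewrite -dvdn1 -h dvdn_gen_gcd_root //.
  have := dvdnn (gen_gcd_root s a (l ^ s)).
  rewrite dvdn_gen_gcd_root // => /andP[-> /dvdn_trans ->] //.
  exact: dvdn_exp2r.
apply/eqP; rewrite eqn_leq gen_gcd_root_gt0 // andbT leqNgt; apply/negP.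
move=> /pdivP[p p_pr]; rewrite dvdn_gen_gcd_root // dvdn_pexp2r // => /andP[pa pL].
have pl : p %| l.
  by have := dvdn_trans pL Lle; rewrite Euclid_dvdX // => /andP[].
have : p %| 1 by rewrite -h dvdn_gen_gcd_root // pa dvdn_pexp2r.
by rewrite dvdn1 => /eqP p1; rewrite p1 in p_pr.
Qed.

End GenGcdRoot.

(** * Sums over residues and over divisors *)

Lemma sum_nat_multiples (V : nmodType) (c g : nat) (F : nat -> V) : 0 < g ->
  (\sum_(0 <= k < c * g | (g %| k)%N) F k = \sum_(0 <= j < c) F (j * g)%N)%R.
Proof.
move=> g_gt0; elim: c => [|c IH]; first by rewrite mul0n !big_nil.
rewrite big_nat_recr //= -IH (@big_cat_nat _ _ _ (c * g)) //=; last first.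
  by rewrite leq_mul2r leqnSn orbT.
congr (_ + _)%R; rewrite mulSn big_ltn_cond; last first.
  by rewrite -[X in X < _]add0n ltn_add2r.
rewrite dvdn_mull // [X in (_ + X)%R]big_nat_cond big1 ?addr0 // => k.
case/andP=> /andP[lo hi] /dvdnP[j jE]; move: lo hi.
rewrite jE -mulSn !ltn_mul2r g_gt0 /= ltnS.
by move=> lo /(leq_trans lo); rewrite ltnn.
Qed.

Lemma sum_nat_periodic (p c : nat) (F : nat -> nat) :
  (forall k, F (k + p) = F k) ->
  \sum_(0 <= k < c * p) F k = c * \sum_(0 <= k < p) F k.
Proof.
move=> per; have perM j k : F (k + j * p) = F k.
  by elim: j => [|j IH]; rewrite ?mul0n ?addn0 // mulSnr addnA per.
elim: c => [|c IH]; first by rewrite !mul0n big_nil.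
rewrite mulSn addnC (@big_cat_nat _ _ _ (c * p)) ?leq_addr //= IH.
rewrite -{1}[c * p]add0n big_addn addKn mulSn [RHS]addnC; congr (_ + _).
by apply: eq_bigr => k _; rewrite perM.
Qed.

Section DivisorSums.

Variables (V : nmodType) (F : nat -> V).

Lemma sum_divisors_sub (D N : nat) : 0 < N -> D %| N ->
  (\sum_(l <- divisors D) F l = \sum_(l <- divisors N | (l %| D)%N) F l)%R.
Proof.
move=> N_gt0 DN; have D_gt0 := dvdn_gt0 N_gt0 DN.
rewrite -[RHS]big_filter; apply/perm_big/uniq_perm.
- exact: divisors_uniq.
- exact/filter_uniq/divisors_uniq.
move=> l; rewrite mem_filter -!dvdn_divisors //.
by case: (boolP (l %| D)) => // /dvdn_trans ->.
Qed.

Lemma sum_divisors_compl (L : nat) : 0 < L ->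
  (\sum_(l <- divisors L) F (L %/ l)%N = \sum_(l <- divisors L) F l)%R.
Proof.
move=> L_gt0; have invK l : l %| L -> L %/ (L %/ l) = l.
  move=> lL; have l_gt0 := dvdn_gt0 L_gt0 lL.
  have q_gt0 : 0 < L %/ l by rewrite divn_gt0 // dvdn_leq.
  by rewrite -[X in X %/ _ = _](divnK lL) mulKn.
rewrite -(big_map (divn L) xpredT F); apply/perm_big/uniq_perm.
- rewrite map_inj_in_uniq ?divisors_uniq // => x y.
  by rewrite -!dvdn_divisors // => /invK {2}<- /invK {2}<- ->.
- exact: divisors_uniq.
move=> l; rewrite -dvdn_divisors //; apply/mapP/idP => [[x] | lL].
  by rewrite -dvdn_divisors // => xL ->; apply: dvdn_div.
by exists (L %/ l); rewrite -?dvdn_divisors ?dvdn_div // invK.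
Qed.

End DivisorSums.

Lemma count_divisors_multiple (g B : nat) : 0 < g -> 0 < B ->
  count (dvdn g) (divisors (g * B)) = size (divisors B).
Proof.
move=> g_gt0 B_gt0; have gB_gt0 : 0 < g * B by rewrite muln_gt0 g_gt0.
rewrite -size_filter -[RHS](size_map (muln g)); apply/perm_size/uniq_perm.
- exact/filter_uniq/divisors_uniq.
- rewrite map_inj_uniq ?divisors_uniq // => x y /eqP.
  by rewrite eqn_pmul2l // => /eqP.
move=> l; rewrite mem_filter -dvdn_divisors //; apply/andP/mapP.
  case=> /dvdnP[j ->]; rewrite mulnC dvdn_pmul2l // => jB.
  by exists j; rewrite -?dvdn_divisors.
by case=> j; rewrite -dvdn_divisors // => jB ->; rewrite dvdn_mulr ?dvdn_pmul2l.
Qed.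

(** * Klee's function and the divisor function *)

Section Klee.

Variable s : nat.
Hypothesis s_gt0 : 0 < s.

Lemma gen_tau_exp (B : nat) : 0 < B -> gen_tau s (B ^ s) = size (divisors B).
Proof.
move=> B_gt0; have Bs_gt0 : 0 < B ^ s by rewrite expn_gt0 B_gt0.
rewrite /gen_tau -size_filter -[RHS](size_map (expn^~ s)).
apply/perm_size/uniq_perm.
- exact/filter_uniq/divisors_uniq.
- by rewrite map_inj_uniq ?divisors_uniq //; apply: expIn.
move=> e; rewrite mem_filter -dvdn_divisors //; apply/andP/mapP.
  case=> /existsP[l /eqP ->]; rewrite dvdn_pexp2r // => lB.
  by exists (nat_of_ord l); rewrite -?dvdn_divisors.
case=> l; rewrite -dvdn_divisors // => lB ->; rewrite dvdn_pexp2r //.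
split=> //; apply/existsP.
have l_lt : l < (l ^ s).+1 by rewrite ltnS leq_root_exp.
by exists (Ordinal l_lt).
Qed.

(** Replacing the residue n by 0 allows the sum to be compared with
    [sum_nat_multiples] and [sum_nat_periodic]. *)
Lemma klee_PhiE (n : nat) : 0 < n ->
  klee_Phi s n = \sum_(0 <= k < n) (gen_gcd_root s k n == 1).
Proof.
move=> n_gt0; rewrite /klee_Phi big_mkcond big_nat_recr //=.
rewrite [RHS]big_ltn // addnC; congr (_ + _).
  by rewrite gen_gcd_eq1 // -[n in gen_gcd_root s n n]add0n gen_gcd_root_addr.
by apply: eq_bigr => k _; rewrite gen_gcd_eq1 //; case: eqP.
Qed.

(** Among the residues mod [L ^ s], those with [(k, L ^ s)_s = (L / l) ^ s] are
    the multiples by [(L / l) ^ s] of the residues counted by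
    [klee_Phi s (l ^ s)]. *)
Lemma sum_klee_Phi (L : nat) : 0 < L ->
  \sum_(l <- divisors L) klee_Phi s (l ^ s) = L ^ s.
Proof.
move=> L_gt0; have Ls_gt0 : 0 < L ^ s by rewrite expn_gt0 L_gt0.
rewrite -(sum_divisors_compl (fun l => klee_Phi s (l ^ s))) //.
transitivity (\sum_(0 <= k < L ^ s) \sum_(g <- divisors L)
    (gen_gcd_root s k (L ^ s) == g : nat)); last first.
  transitivity (\sum_(0 <= k < L ^ s) 1); last first.
    by rewrite sum_nat_const_nat subn0 muln1.
  apply: eq_bigr => k _; pose G := gen_gcd_root s k (L ^ s).
  have GL : G \in divisors L.
    rewrite -dvdn_divisors // -(dvdn_pexp2r _ _ s_gt0).
    by have := dvdnn G; rewrite dvdn_gen_gcd_root // => /andP[].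
  rewrite -/G (bigD1_seq G) ?divisors_uniq //= eqxx big1 ?addn0 // => g.
  by rewrite eq_sym => /negPf ->.
rewrite exchange_big /=; apply: eq_big_seq => g; rewrite -dvdn_divisors // => gL.
have g_gt0 := dvdn_gt0 L_gt0 gL; have gs_gt0 : 0 < g ^ s by rewrite expn_gt0 g_gt0.
have c_gt0 : 0 < L %/ g by rewrite divn_gt0 // dvdn_leq.
have cs_gt0 : 0 < (L %/ g) ^ s by rewrite expn_gt0 c_gt0.
have LE : L ^ s = (L %/ g) ^ s * g ^ s by rewrite -expnMn divnK.
rewrite klee_PhiE //.
transitivity (\sum_(0 <= k < (L %/ g) ^ s * g ^ s | g ^ s %| k)
    (gen_gcd_root s k (L ^ s) == g : nat)).
  rewrite (sum_nat_multiples _ (fun k => (gen_gcd_root s k (L ^ s) == g : nat))) //.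
  apply: eq_bigr => j _; rewrite LE gen_gcd_root_pmul2r //.
  by congr nat_of_bool; rewrite -[LHS](eqn_pmul2r g_gt0) mul1n.
rewrite -LE big_mkcond; apply: eq_bigr => k _; case: ifPn => // ndvd.
apply/esym/eqP; rewrite eqb0; apply: contra ndvd => /eqP gE.
by have := dvdnn g; rewrite -{2}gE dvdn_gen_gcd_root // => /andP[].
Qed.

(** When l and L have the same primes, the condition counted by [klee_Phi] is
    the same for both and is periodic mod [l ^ s]. *)
Lemma klee_Phi_radical (l L e : nat) : 0 < L -> l %| L -> L %| l ^ e ->
  klee_Phi s (L ^ s) = (L %/ l) ^ s * klee_Phi s (l ^ s).
Proof.
move=> L_gt0 lL Lle; have l_gt0 := dvdn_gt0 L_gt0 lL.
have ls_gt0 : 0 < l ^ s by rewrite expn_gt0 l_gt0.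
rewrite !klee_PhiE ?expn_gt0 ?L_gt0 ?l_gt0 //.
rewrite -sum_nat_periodic; last by move=> k; rewrite gen_gcd_root_addr.
rewrite -expnMn divnK //; apply: eq_bigr => k _.
by rewrite (gen_gcd_root_eq1_radical s_gt0 k L_gt0 lL Lle).
Qed.

(** This is [sum_klee_Phi] for the root of the gcd; the sum runs over all
    divisors of N so that j can be summed first. *)
Lemma gen_gcd_sum_klee (j N : nat) : 0 < N ->
  gen_gcd s j (N ^ s) =
  \sum_(l <- divisors N | l ^ s %| j) klee_Phi s (l ^ s).
Proof.
move=> N_gt0; have Ns_gt0 : 0 < N ^ s by rewrite expn_gt0 N_gt0.
pose G := gen_gcd_root s j (N ^ s).
have dvdG l : (l %| G) = (l ^ s %| j) && (l %| N).
  by rewrite dvdn_gen_gcd_root // (dvdn_pexp2r _ _ s_gt0).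
have GN : G %| N by have := dvdnn G; rewrite dvdG => /andP[].
rewrite gen_gcdE // -sum_klee_Phi ?gen_gcd_root_gt0 // -/G.
rewrite (sum_divisors_sub _ N_gt0 GN) big_seq_cond [RHS]big_seq_cond.
apply: eq_bigl => l; rewrite -dvdn_divisors //.
by case: (boolP (l %| N)) => //= lN; rewrite dvdG lN andbT.
Qed.

End Klee.

(** * Characters on the residues congruent to 1 *)

Section Dirichlet.

Local Open Scope ring_scope.

Variables (R : realType) (n : nat) (chi : int -> R[i]).
Hypothesis hchi : dirichlet_character n chi.

Lemma chi_congr (a b : int) : (n %| a - b)%Z -> chi a = chi b.
Proof.
have per (c : nat) x : chi (x + c%:Z * n%:Z) = chi x.
  elim: c => [|c IH]; first by rewrite mul0r addr0.
  by rewrite intS mulrDl mul1r addrCA addrC (dirichlet_periodic hchi).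
case/dvdzP=> [[c|c]] /eqP; rewrite subr_eq addrC => /eqP ->; first exact: per.
by rewrite NegzE mulNr -(per c.+1) subrK.
Qed.

Lemma chi1 : chi 1 = 1.
Proof.
have c1_neq0 : chi 1 != 0 by rewrite (dirichlet_eq0 hchi) negbK coprimezE coprime1n.
by apply: (mulIf c1_neq0); rewrite -(dirichlet_mul hchi) !mul1r.
Qed.

Lemma coprimez_inv (a : int) : coprimez a n -> exists c : int, (n %| a * c - 1)%Z.
Proof.
case/coprimezP=> [[u v] /= uv1]; exists u.
by rewrite -uv1 mulrC opprD ?addNKr rpredN dvdz_mull.
Qed.

Lemma coprimez_congr (d : nat) (a b : int) :
  (d %| a - b)%Z -> coprimez a d = coprimez b d.
Proof.
rewrite -eqz_mod_dvd => /eqP ab.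
by rewrite /coprimez -gcdz_modl ab gcdz_modl.
Qed.

(** Both sides become the value at a unit congruent to 1 mod d after
    multiplication by an inverse c of b mod n. *)
Lemma chi_congr_induced (d : nat) (a b : int) : induced_modulus n chi d ->
  coprimez a n -> coprimez b n -> (d %| a - b)%Z -> chi a = chi b.
Proof.
move=> [dn ind] an bn dab; have [c bc1] := coprimez_inv bn.
have chibc : chi b * chi c = 1 by rewrite -(dirichlet_mul hchi) (chi_congr bc1) chi1.
have cn : coprimez c n.
  rewrite -[coprimez _ _]negbK -(dirichlet_eq0 hchi); apply/eqP => c0.
  by move/eqP: chibc; rewrite c0 mulr0 eq_sym oner_eq0.
have c_neq0 : chi c != 0 by rewrite (dirichlet_eq0 hchi) negbK.
apply: (mulIf c_neq0); rewrite chibc -(dirichlet_mul hchi); apply: ind.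
  by rewrite coprimezMl an.
apply/eqP; rewrite eqz_mod_dvd -(subrK (b * c) (a * c)) -mulrBl -addrA.
rewrite rpredD ?dvdz_mulr //.
by apply: dvdz_trans bc1; rewrite dvdzE.
Qed.

(** Given [k = 1] mod [gcd d e], the Chinese remainder theorem yields b with
    [b = 1] mod e and [b = k] mod d. Since d has the same primes as n, b is a
    unit mod n, whence [chi k = chi b = 1]. *)
Lemma induced_modulus_gcd (d e : nat) :
    (forall a : int, coprimez a d -> coprimez a n) ->
    induced_modulus n chi d -> induced_modulus n chi e ->
  induced_modulus n chi (gcdn d e).
Proof.
move=> rad indd inde; have [dn _] := indd; have [en inde1] := inde.
split; first exact: dvdn_trans (dvdn_gcdl d e) dn.
move=> k kn /eqP; rewrite eqz_mod_dvd => /dvdzP[y ky].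
have [u [v uv]] := Bezoutz d e.
have guv : (gcdn d e)%:Z = u * d%:Z + v * e%:Z by rewrite uv.
pose b : int := 1 + y * v * e%:Z.
have bk : (d %| k - b)%Z.
  rewrite /b opprD addrA ky guv mulrDr -mulrA addrK.
  by rewrite mulrA dvdz_mull.
have kd : coprimez k d by apply: coprimez_dvdr kn.
have bn : coprimez b n by apply: rad; rewrite -(coprimez_congr bk).
rewrite (chi_congr_induced indd kn bn bk); apply: inde1 => //.
by apply/eqP; rewrite eqz_mod_dvd /b addrC addKr dvdz_mull.
Qed.

(** The sum runs over the residues [j + 1] that are congruent to 1 mod e. They
    are coprime to e, hence units mod n, and each contributes 1. *)
Lemma sum_chi_induced (e : nat) : (0 < n)%N ->
    (forall a : int, coprimez a e -> coprimez a n) -> induced_modulus n chi e ->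
  \sum_(0 <= j < n | (e %| j)%N) chi j.+1%:Z = (n %/ e)%:R.
Proof.
move=> n_gt0 rad [en ind]; have e_gt0 := dvdn_gt0 n_gt0 en.
transitivity (\sum_(0 <= j < n | (e %| j)%N) (1 : R[i])).
  apply: eq_bigr => j ej.
  have j1 : (e %| j.+1%:Z - 1)%Z by rewrite intS addrC addKr dvdzE.
  apply: ind; last by apply/eqP; rewrite eqz_mod_dvd.
  by apply: rad; rewrite (coprimez_congr j1) coprimezE coprime1n.
rewrite -{1}(divnK en) (sum_nat_multiples _ (fun=> 1)) //.
by rewrite big_const_nat subn0 iter_addr_0.
Qed.

(** Multiplication by a unit a congruent to 1 mod e permutes the residues
    congruent to 1 mod e, so it scales their character sum by [chi a]. *)
Lemma sum_chi_scale (e : nat) (a : int) : (0 < n)%N -> (e %| n)%N ->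
    coprimez a n -> (e %| a - 1)%Z ->
  chi a * \sum_(0 <= j < n | (e %| j)%N) chi j.+1%:Z =
  \sum_(0 <= j < n | (e %| j)%N) chi j.+1%:Z.
Proof.
move=> n_gt0 en an ea.
have nz0 : n%:Z != 0 by rewrite eqz_nat -lt0n.
(* the residue j stands for j + 1, hence the shifts by 1 *)
pose h0 (j : 'I_n) : nat := `|((a * j.+1%:Z - 1) %% n)%Z|%N.
have h0E j : (h0 j)%:Z = ((a * j.+1%:Z - 1) %% n)%Z.
  by rewrite /h0 gez0_abs ?modz_ge0.
have h0_lt j : (h0 j < n)%N by rewrite -ltz_nat h0E ltz_pmod.
pose h j := Ordinal (h0_lt j).
have hcong j : (n %| (h j)%:Z - (a * j.+1%:Z - 1))%Z.
  by rewrite -eqz_mod_dvd /= h0E modz_mod.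
have h_inj : injective h.
  move=> x y hxy; have [c ac1] := coprimez_inv an.
  have := rpredB (hcong y) (hcong x).
  rewrite hxy !intS.
  have -> (H X Y : int) : H - (a * (1 + Y) - 1) - (H - (a * (1 + X) - 1)) =
      a * (X - Y) by ring.
  rewrite Gauss_dvdzr 1?coprimez_sym //.
  rewrite -eqz_mod_dvd !modz_nat !modn_small // => /eqP[] /val_inj //.
rewrite !big_mkord [RHS](reindex_inj h_inj) mulr_sumr /=; apply: eq_big => j.
  have e_h : (e %| (h j)%:Z - (a * j.+1%:Z - 1))%Z.
    by apply: dvdz_trans (hcong j); rewrite dvdzE.
  have -> : (e %| h0 j)%N = (e %| (h j)%:Z)%Z by rewrite dvdzE.
  rewrite -(subrK (a * j.+1%:Z - 1) (h j)%:Z) rpredDl //.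
  have -> : a * j.+1%:Z - 1 = (a - 1) * j.+1%:Z + j%:Z.
    by rewrite mulrBl mul1r intS -addrA opprD addrNK.
  by rewrite rpredDl ?dvdz_mulr // dvdzE.
move=> _; rewrite -(dirichlet_mul hchi); apply/esym/chi_congr.
by have := hcong j; rewrite opprB addrCA addrA intS.
Qed.

(** If the sum is nonzero it can be cancelled in [sum_chi_scale], so that
    [chi a = 1] for all units a congruent to 1 mod e. *)
Lemma sum_chi_not_induced (e : nat) : (0 < n)%N -> (e %| n)%N ->
    ~ induced_modulus n chi e ->
  \sum_(0 <= j < n | (e %| j)%N) chi j.+1%:Z = 0.
Proof.
move=> n_gt0 en nind; apply/eqP/negPn/negP => S_neq0; apply: nind.
split=> // a an /eqP; rewrite eqz_mod_dvd => ea.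
by apply: (mulIf S_neq0); rewrite mul1r sum_chi_scale.
Qed.

End Dirichlet.

(** * Evaluation of the character sum *)

Local Open Scope ring_scope.

Theorem theorem1p2 (R : realType) (m q s n : nat)
    (hm : (0 < m)%N) (hq : (0 < q)%N) (hs : (0 < s)%N)
    (hn : n = (m ^ (q * s))%N)
    (chi : int -> R[i]) (hchi : dirichlet_character n chi)
    (t d : nat) (ht : (1 <= t <= q)%N) (hd : d = (m ^ (t * s))%N)
    (hcond : is_conductor n chi d) :
  \sum_(1 <= k < n.+1 | gen_gcd s k n == 1%N)
     (gen_gcd s (k - 1) n)%:R * chi k%:Z
  = (klee_Phi s n * gen_tau s (n %/ d))%:R.
Proof.
have [/andP[t_gt0 tq] [indd mind]] := (ht, hcond).
pose N := (m ^ q)%N; have N_gt0 : (0 < N)%N by rewrite expn_gt0 hm.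
have nE : n = (N ^ s)%N by rewrite hn expnM.
have dE : d = ((m ^ t) ^ s)%N by rewrite hd expnM.
have n_gt0 : (0 < n)%N by rewrite nE expn_gt0 N_gt0.
have mt_gt0 : (0 < m ^ t)%N by rewrite expn_gt0 hm.
have radical e (a : int) : (m %| e)%N -> coprimez a e -> coprimez a n.
  move=> me /(coprimez_dvdr me); rewrite !coprimezE hn => am.
  exact: coprimeXr.
have md : (m %| d)%N by rewrite hd dvdn_exp // muln_gt0 t_gt0.
transitivity (\sum_(0 <= j < n) (gen_gcd s j n)%:R * chi j.+1%:Z).
  rewrite big_add1 /= big_mkcond; apply: eq_bigr => j _.
  rewrite subn1 /= gen_gcd_eq1 //; case: ifPn => // gcd_neq1.
  suff /eqP -> : chi j.+1%:Z == 0 by rewrite mulr0.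
  rewrite (dirichlet_eq0 hchi) coprimezE; apply: contra gcd_neq1 => cop.
  rewrite -dvdn1 -(eqP cop) dvdn_gcd.
  have := dvdnn (gen_gcd_root s j.+1 n).
  rewrite dvdn_gen_gcd_root // => /andP[ga gb].
  have root_dvd x y : (x ^ s %| y -> x %| y)%N.
    by apply: dvdn_trans; apply: dvdn_exp.
  by rewrite (root_dvd _ _ ga) (root_dvd _ _ gb).
transitivity (\sum_(l <- divisors N) (klee_Phi s (l ^ s))%:R *
    \sum_(0 <= j < n | (l ^ s %| j)%N) chi j.+1%:Z).
  under eq_bigr => j _ do rewrite [X in gen_gcd s j X]nE gen_gcd_sum_klee //
    natr_sum mulr_suml big_mkcond.
  rewrite exchange_big /=; apply: eq_bigr => l _.
  by rewrite mulr_sumr -big_mkcond.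
transitivity (\sum_(l <- divisors N | (m ^ t %| l)%N) ((klee_Phi s n)%:R : R[i])).
  rewrite [RHS]big_mkcond; apply: eq_big_seq => l; rewrite -dvdn_divisors // => lN.
  have ln : (l ^ s %| n)%N by rewrite nE dvdn_exp2r.
  have l_gt0 := dvdn_gt0 N_gt0 lN.
  case: ifPn => [mtl | ndvd].
    have ml : (m %| l)%N by apply: dvdn_trans mtl; apply: dvdn_exp.
    have dl : (d %| l ^ s)%N by rewrite dE dvdn_exp2r.
    have indl : induced_modulus n chi (l ^ s).
      split=> // a an al; apply: indd.2 => //; apply/eqP; move/eqP: al.
      by rewrite !eqz_mod_dvd; apply: dvdz_trans; rewrite dvdzE.
    rewrite (sum_chi_induced n_gt0 _ indl); last first.
      by move=> a; apply: radical; apply: dvdn_exp.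
    have -> : (n %/ l ^ s = (N %/ l) ^ s)%N.
      by rewrite nE -{1}(divnK lN) expnMn mulnK // expn_gt0 l_gt0.
    by rewrite -natrM mulnC nE (klee_Phi_radical hs N_gt0 lN (dvdn_exp2r q ml)).
  rewrite (sum_chi_not_induced hchi) ?mulr0 // => indl; case/negP: ndvd.
  (* d is minimal among induced moduli, so it equals this gcd *)
  have indg := induced_modulus_gcd hchi (fun a => radical d a md) indd indl.
  rewrite -(dvdn_pexp2r _ _ hs) -dE; apply/gcdn_idPl/eqP.
  rewrite eqn_leq (mind _ indg) andbT dvdn_leq ?dvdn_gcdl //.
  by rewrite dE expn_gt0 mt_gt0.
have NE : N = (m ^ t * m ^ (q - t))%N by rewrite -expnD subnKC.
have -> : (n %/ d = (m ^ (q - t)) ^ s)%N.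
  by rewrite nE dE NE expnMn mulKn // expn_gt0 mt_gt0.
rewrite gen_tau_exp ?expn_gt0 ?hm //.
rewrite -(@count_divisors_multiple (m ^ t)) ?expn_gt0 ?hm // -NE.
by rewrite big_const_seq iter_addr_0 natrM mulr_natr.
Qed.
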